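(* Let $n>1$ be an integer, and let $p,p^{\ast}$ be such that either (i) $1\le p<n$ and $\frac1{p^{\ast}}=\frac1p-\frac1n$, or (ii) $p=n$ and $p^{\ast}\in[p,\infty)$. Then there exists a constant $C$, independent of the mesh size $h$, such that for every $h=1/(N+1)$ with $N\in\mathbb N$ and every $u:\overline{\mathcal M}\to\mathbb R$ with $u=0$ on $\partial\mathcal M$, $$\|u\|_{L^{p^{\ast}}_h(\mathcal M)}\le C\,\|u\|_{W^{1,p}_h(\mathcal M)}.$$
   Context: Mesh. Let $n\ge 2$, $G=(0,1)^n$, $N\in\mathbb N$, $h=1/(N+1)$, $\mathcal K=\{ih: i=1,\dots,N\}$ and $\mathcal M=G\cap\mathcal K^n=\{h,2h,\dots,Nh\}^n$. Let $e_1,\dots,e_n$ be the canonical basis of $\mathbb R^n$. For a regular mesh $\mathcal W$ put $\mathcal W_i^{\ast}=\{x+\frac h2e_i:x\in\mathcal W\}\cup\{x-\frac h2e_i:x\in\mathcal W\}$, and let $\overline{\mathcal M}_{ii}=(\mathcal M_i^{\ast})_i^{\ast}$. Set $\partial_i\mathcal M=\overline{\mathcal M}_{ii}\setminus\mathcal M$, $\partial\mathcal M=\bigcup_{i=1}^n\partial_i\mathcal M$, $\overline{\mathcal M}=\mathcal M\cup\partial\mathcal M$. Difference operator. For $u:\overline{\mathcal M}\to\mathbb R$ and $x\in\mathcal M_i^{\ast}$, $D_iu(x)=\frac1h\left(u(x+\frac h2e_i)-u(x-\frac h2e_i)\right)$. Norms. For a function $v$ on a mesh $\mathcal W$ ($\mathcal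 W=\mathcal M$ or $\mathcal M_i^{\ast}$), $\int_{\mathcal W}v=h^n\sum_{x\in\mathcal W}v(x)$ and, for $1\le p<\infty$, $\|v\|_{L^p_h(\mathcal W)}=\left(\int_{\mathcal W}|v|^p\right)^{1/p}$. For $u:\overline{\mathcal M}\to\mathbb R$ and $1\le p<\infty$, $$\|u\|_{W^{1,p}_h(\mathcal M)}=\Big(\|u\|^p_{L^p_h(\mathcal M)}+\sum_{i=1}^n\|D_iu\|^p_{L^p_h(\mathcal M_i^{\ast})}\Big)^{1/p}.$$ *)

(* Defs.v *)
From mathcomp Require Import all_boot all_order all_algebra.
From mathcomp Require Import all_classical all_reals all_analysis.

Set Implicit Arguments.
Unset Strict Implicit.
Unset Printing Implicit Defensive.

Import Order.TTheory GRing.Theory Num.Theory.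

Local Open Scope classical_set_scope.
Local Open Scope ring_scope.

Section Mesh.
Variables (R : realType) (n N : nat).

Definition mesh_size : R := (N.+1%:R)^-1.

Definition unit_cube : set 'rV[R]_n := [set x | forall j, 0 < x 0 j < 1].

Definition mesh_nodes : set R :=
  [set i%:R * mesh_size | i in [set i : nat | (1 <= i <= N)%N]].

Definition mesh : set 'rV[R]_n :=
  unit_cube `&` [set x | forall j, mesh_nodes (x 0 j)].

Definition half_step (i : 'I_n) : 'rV[R]_n := (mesh_size / 2) *: delta_mx 0 i.

Definition dual_mesh (i : 'I_n) (W : set 'rV[R]_n) : set 'rV[R]_n :=
  [set x + half_step i | x in W] `|` [set x - half_step i | x in W].

Definition mesh_boundary_dir (i : 'I_n) : set 'rV[R]_n :=
  dual_mesh i (dual_mesh i mesh) `\` mesh.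

Definition mesh_boundary : set 'rV[R]_n :=
  \bigcup_(i in [set: 'I_n]) mesh_boundary_dir i.

Definition mesh_closure : set 'rV[R]_n := mesh `|` mesh_boundary.

Definition mesh_diff (i : 'I_n) (u : 'rV[R]_n -> R) (x : 'rV[R]_n) : R :=
  mesh_size^-1 * (u (x + half_step i) - u (x - half_step i)).

(* The finitely supported sum is 0 by convention when the support in [W] is   *)
(* infinite; see [finite_mesh] and [finite_dual_mesh].                        *)
Definition mesh_integral (W : set 'rV[R]_n) (v : 'rV[R]_n -> R) : R :=
  mesh_size ^+ n * \sum_(x \in W) v x.

Definition mesh_Lnorm (p : R) (W : set 'rV[R]_n) (v : 'rV[R]_n -> R) : R :=
  mesh_integral W (fun x => `|v x| `^ p) `^ p^-1.

Definition mesh_W1norm (p : R) (u : 'rV[R]_n -> R) : R :=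
  (mesh_Lnorm p mesh u `^ p
   + \sum_(i < n) mesh_Lnorm p (dual_mesh i mesh) (mesh_diff i u) `^ p) `^ p^-1.

Lemma finite_mesh : finite_set mesh.
Proof.
pose f (k : {ffun 'I_n -> 'I_N.+1}) : 'rV[R]_n :=
  \row_j ((k j)%:R * mesh_size).
apply: (@sub_finite_set _ _ (f @` [set: {ffun 'I_n -> 'I_N.+1}])); last first.
  exact/finite_image/finite_finset.
move=> x [_ /= hx].
have hk j : exists k : 'I_N.+1, k%:R * mesh_size = x 0 j.
  have [i /= /andP[_ iN] <-] := hx j.
  by exists (inord i); rewrite inordK.
have [k hk'] := choice hk.
by exists (finfun k) => //; apply/rowP => j; rewrite mxE ffunE.
Qed.

Lemma finite_dual_mesh i W : finite_set W -> finite_set (dual_mesh i W).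
Proof. by move=> fW; rewrite finite_setU; split; exact: finite_image. Qed.

(* A function on [mesh_closure] is represented by a total function; its       *)
(* differences on the dual meshes do not depend on the extension.             *)
Lemma eq_mesh_diff i u v : {in mesh_closure, u =1 v} ->
  {in dual_mesh i mesh, mesh_diff i u =1 mesh_diff i v}.
Proof.
have sub y : dual_mesh i (dual_mesh i mesh) y -> y \in mesh_closure.
  move=> hy; rewrite inE; have [hm|hm] := pselect (mesh y); first by left.
  by right; exists i.
move=> uv x; rewrite inE => hx; rewrite /mesh_diff !uv //; apply: sub.
  by right; exists x.
by left; exists x.
Qed.

End Mesh.

(* Main.v *)
Require Import Defs.
From mathcomp Require Import all_boot all_order all_algebra.
From mathcomp Require Import all_classical all_reals all_analysis.
From mathcomp Require Import ring lra.

(** Why the inequality holds.  After rescaling by [h], the mesh sits in the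
    discrete torus [{ffun 'I_n -> 'I_N.+1}]: the coordinates [1..N] are the mesh
    points, and the single coordinate [0] stands for both opposite faces of the
    boundary, where [u] vanishes.  Extending [u] by zero turns its differences
    on the dual meshes into cyclic differences, and the problem becomes an
    inequality between finite sums over this torus.

    There the proof is that of Gagliardo and Nirenberg.  A function [F] that
    vanishes at coordinate [0] is bounded at a point by the sum of its
    differences along each of the [n] lines through it.  The product of the [n]
    bounds, to the power [1/(n-1)], is summed by the Loomis-Whitney inequality
    [loomis_whitney], which gives the case [r = 1] ([discrete_gagliardo]).
    Applying that case to [|F|^g] for a suitable [g], and estimating
    [|a^g - b^g| <= g |a - b| (a^(g-1) + b^(g-1))] by Hoelder, gives
    [discrete_sobolev] for all [1 <= r < n] with [1/q = 1/r - 1/n]; both the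
    Loomis-Whitney and the Hoelder inequality are instances of
    [sum_prod_powR_le], itself a consequence of the weighted inequality of
    arithmetic and geometric means.

    Finally [mesh_sobolev] restores the powers of [h] and passes from the
    exponent [r] to any [p >= r] at no loss in [h], as the mesh has bounded
    total mass.  For [p < n] the theorem is the case [r = p]; for [p = n] it
    is the case [1/r = 1/pstar + 1/n], where [n >= 2] ensures [r >= 1]. *)

Set Implicit Arguments.
Unset Strict Implicit.
Unset Printing Implicit Defensive.

Import Order.TTheory GRing.Theory Num.Theory.

Local Open Scope classical_set_scope.
Local Open Scope ring_scope.

(** * Arithmetic-geometric mean and Hoelder inequalities for finite sums *)

Section Powers.
Variable R : realType.
Implicit Types (x y a b c g : R).

(** The tangent line bound [ln x <= x - 1], in a form that stays true at
    [x = 0] and thereby spares the case analysis on vanishing factors below. *)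
Lemma powR_le_expR x c : 0 <= x -> 0 <= c -> x `^ c <= expR (c * (x - 1)).
Proof.
move=> x0 c0; have [->|xn0] := eqVneq x 0.
  have [->|cn0] := eqVneq c 0; first by rewrite powRr0 mul0r expR0.
  by rewrite powR0 ?expR_ge0.
rewrite /powR (negbTE xn0) ler_expR ler_wpM2l //.
have x_gt0 : 0 < x by rewrite lt_def xn0.
by rewrite -[X in ln X](subrKC 1) le_ln1Dx //; lra.
Qed.

(** Once the [F i] are divided by their weighted mean [m], the tangent bounds
    multiply to the exponential of [\sum_i c i * (F i / m - 1) = 0]. *)
Lemma weighted_AGM (I : finType) (P : pred I) (c F : I -> R) :
    (forall i, P i -> 0 <= c i) -> \sum_(i | P i) c i = 1 ->
    (forall i, P i -> 0 <= F i) ->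
  \prod_(i | P i) F i `^ c i <= \sum_(i | P i) c i * F i.
Proof.
move=> c0 c1 F0; set m := \sum_(i | P i) c i * F i.
have cF0 i : P i -> 0 <= c i * F i by move=> Pi; rewrite mulr_ge0 ?c0 ?F0.
have m0 : 0 <= m by exact: sumr_ge0.
have [mE|mn0] := eqVneq m 0.
  (* some factor with a positive weight vanishes, and so does the product *)
  have [/= j] : {j | P j && (c j != 0)}.
    apply: sigW; apply: contrapT => nj.
    move/eqP: c1; rewrite big1 ?(eq_sym 0) ?oner_eq0 // => i Pi.
    by apply/eqP/negPn/negP => ci; apply: nj; exists i; rewrite Pi.
  move=> /andP[Pj cj]; rewrite mE (bigD1 j) //=.
  have /eqP : c j * F j = 0.
    apply/eqP; rewrite eq_le cF0 // andbT -mE /m (bigD1 j) //= lerDl.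
    by apply: sumr_ge0 => i /andP[Pi _]; exact: cF0.
  by rewrite mulf_eq0 (negbTE cj) => /eqP ->; rewrite powR0 // mul0r.
have m_gt0 : 0 < m by rewrite lt_def mn0.
have -> : \prod_(i | P i) F i `^ c i
    = m * \prod_(i | P i) (F i / m) `^ c i.
  transitivity (\prod_(i | P i) (m `^ c i * (F i / m) `^ c i)).
    apply: eq_bigr => i Pi; rewrite -powRM ?divr_ge0 ?F0 //.
    by rewrite mulrCA divff // mulr1.
  rewrite big_split /=; congr (_ * _).
  rewrite /powR (negbTE mn0) -expR_sum -mulr_suml c1 mul1r lnK //.
rewrite ger_pMr //.
have {2}-> : 1 = \prod_(i | P i) expR (c i * (F i / m - 1)).
  rewrite -expR_sum -[LHS]expR0; congr expR.
  under eq_bigr do rewrite mulrBr mulr1 mulrA.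
  by rewrite big_split /= sumrN c1 -mulr_suml divff // subrr.
apply: ler_prod => i Pi; rewrite powR_ge0 powR_le_expR ?c0 //.
by rewrite divr_ge0 ?F0.
Qed.

(** Hoelder's inequality for several functions: divide each [F i] by its sum,
    apply the weighted mean inequality at every [t], and sum over [t].  Zero
    weights are allowed, which later makes the exponent [r = 1] no exception. *)
Lemma sum_prod_powR_le (I T : finType) (P : pred I) (c : I -> R)
    (F : I -> T -> R) :
    (forall i, P i -> 0 <= c i) -> \sum_(i | P i) c i = 1 ->
    (forall i t, P i -> 0 <= F i t) ->
  \sum_t \prod_(i | P i) F i t `^ c i
    <= \prod_(i | P i) (\sum_t F i t) `^ c i.
Proof.
move=> c0 c1 F0; set S := fun i => \sum_t F i t.
have S0 i : P i -> 0 <= S i by move=> Pi; apply: sumr_ge0 => t _; exact: F0.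
(* when [S i = 0] the division is by zero, but then [F i t = 0] as well *)
have FS i t : P i -> F i t `^ c i = S i `^ c i * (F i t / S i) `^ c i.
  move=> Pi; rewrite -powRM ?divr_ge0 ?F0 ?S0 // mulrCA.
  have [Si0|Sn0] := eqVneq (S i) 0; last by rewrite divff // mulr1.
  have /eqP/psumr_eq0P : \sum_t F i t == 0 by apply/eqP.
  by move=> -> //; [rewrite mul0r|move=> ? _; exact: F0].
have -> : \sum_t \prod_(i | P i) F i t `^ c i
    = \prod_(i | P i) S i `^ c i
      * \sum_t \prod_(i | P i) (F i t / S i) `^ c i.
  rewrite mulr_sumr; apply: eq_bigr => t _; rewrite -big_split /=.
  by apply: eq_bigr => i Pi; exact: FS.
rewrite -[leRHS]mulr1 ler_wpM2l ?prodr_ge0 //.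
  by move=> i _; exact: powR_ge0.
apply: (@le_trans _ _ (\sum_t \sum_(i | P i) c i * (F i t / S i))).
  apply: ler_sum => t _; apply: weighted_AGM => // i Pi.
  by rewrite divr_ge0 ?F0 ?S0.
rewrite exchange_big /= -[leRHS]c1; apply: ler_sum => i Pi.
rewrite -mulr_sumr -mulr_suml ler_piMr ?c0 //.
rewrite -/(S i); have [->|?] := eqVneq (S i) 0; first by rewrite mul0r.
by rewrite divff.
Qed.

Lemma natr_mul1_ge0 (m : nat) c : m%:R * c = 1 -> 0 <= c.
Proof.
move=> mc; have m0 : m%:R != 0 :> R.
  by apply: contra_eqN mc => /eqP ->; rewrite mul0r eq_sym oner_eq0.
suff -> : c = m%:R^-1 by rewrite invr_ge0.
by apply: (mulfI m0); rewrite mc divff.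
Qed.

Lemma powR_AGM2 a b c : 0 <= a -> 0 <= b -> 0 <= c <= 1 ->
  a `^ c * b `^ (1 - c) <= c * a + (1 - c) * b.
Proof.
move=> a0 b0 /andP[c0 c1].
have := @weighted_AGM bool predT (fun i => if i then c else 1 - c)
  (fun i => if i then a else b).
rewrite !big_bool /=; apply; last by case.
- by case=> // _; rewrite subr_ge0.
- by rewrite subrKC.
Qed.

Lemma hoelder_sum (T : finType) (F G : T -> R) c :
    (forall t, 0 <= F t) -> (forall t, 0 <= G t) -> 0 <= c <= 1 ->
  \sum_t F t `^ c * G t `^ (1 - c)
    <= (\sum_t F t) `^ c * (\sum_t G t) `^ (1 - c).
Proof.
move=> F0 G0 /andP[c0 c1].
have := @sum_prod_powR_le bool T predT (fun i => if i then c else 1 - c)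
  (fun i => if i then F else G).
rewrite !big_bool /=; under eq_bigr do rewrite big_bool /=.
apply; last by case.
- by case=> // _; rewrite subr_ge0.
- by rewrite subrKC.
Qed.

(** For [b <= a] this is [g * b * a^(g-1) <= b^g + (g-1) * a^g], the mean
    inequality for [b^g] and [a^g] with weights [1/g] and [1 - 1/g]. *)
Lemma powR_sub_le a b g : 1 <= g -> 0 <= a -> 0 <= b ->
  `|a `^ g - b `^ g| <= g * (`|a - b| * (a `^ (g - 1) + b `^ (g - 1))).
Proof.
move=> g1; have g0 : 0 < g by lra.
wlog ba : a b / b <= a.
  move=> W a0 b0; have [ba|/ltW ab] := leP b a; first exact: W.
  by rewrite distrC (distrC a) [a `^ _ + _]addrC; exact: W.
move=> a0 b0.
have mono : b `^ g <= a `^ g by rewrite ge0_ler_powR ?nnegrE //; lra.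
rewrite !ger0_norm ?subr_ge0 //.
have gV : 0 <= g^-1 <= 1 by rewrite invr_ge0 invf_le1 // g1 ltW.
have := powR_AGM2 (powR_ge0 b g) (powR_ge0 a g) gV.
rewrite -!powRrM mulrBr mulr1 divff ?gt_eqF // powRr1 // => young.
apply: (@le_trans _ _ (g * ((a - b) * a `^ (g - 1)))); last first.
  rewrite !ler_wpM2l ?subr_ge0 ?(ltW g0) //.
  by rewrite lerDl powR_ge0.
have aE : a `^ g = a * a `^ (g - 1) by rewrite mulr_powRB1.
move: young; rewrite -(ler_pM2l g0) mulrDr !mulrA divff ?gt_eqF//.
rewrite mul1r mulrBr divff ?gt_eqF// mulr1 aE; set w := a `^ (g - 1).
by set z := b `^ g => young; lra.
Qed.

End Powers.

(** * The Loomis-Whitney inequality *)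

Section FibreSums.
Variables (I T : finType).
Implicit Types (x y : {ffun I -> T}) (i j : I) (t : T) (s : seq I).

Definition upd x i t : {ffun I -> T} := [ffun j => if j == i then t else x j].

Definition agree_off s x y := [forall j, (j \in s) || (y j == x j)].

Lemma agree_off_cons s j x y t : j \notin s ->
  agree_off (j :: s) x y && (y j == t) = agree_off s (upd x j t) y.
Proof.
move=> js; apply/idP/idP => [/andP[/forallP H /eqP yj]|/forallP H].
  apply/forallP => k; have := H k; rewrite inE ffunE.
  by case: (eqVneq k j) => [->|//]; rewrite yj eqxx orbT.
apply/andP; split; last by have := H j; rewrite (negbTE js) ffunE eqxx.
apply/forallP => k; have := H k; rewrite inE ffunE.
by case: (eqVneq k j).
Qed.

Lemma upd_eval x i : upd x i (x i) = x.
Proof. by apply/ffunP => j; rewrite ffunE; case: eqP => // ->. Qed.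

Section Sum.
Variable V : nmodType.
Implicit Type f : {ffun I -> T} -> V.

(** The sum over the coordinates in [s], the others being those of [x].  Keeping
    the full point [x] as argument, rather than its remaining coordinates, gives
    all partial sums the same type, so that one induction on [s] suffices. *)
Definition fibre_sum s f x : V := \sum_(y | agree_off s x y) f y.

Lemma eq_fibre_sum s1 s2 f x : s1 =i s2 -> fibre_sum s1 f x = fibre_sum s2 f x.
Proof.
by move=> s12; apply: eq_bigl => y; apply: eq_forallb => j; rewrite s12.
Qed.

Lemma fibre_sum_nil f x : fibre_sum [::] f x = f x.
Proof.
rewrite /fibre_sum (big_pred1 x) // => y /=.
by apply/forallP/eqP => [H|-> j]; rewrite ?eqxx ?orbT //; exact: (iffLR (ffunP _ _) (fun j => eqP (H j))).
Qed.

Lemma fibre_sum_cons s j f x : j \notin s ->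
  fibre_sum (j :: s) f x = \sum_t fibre_sum s f (upd x j t).
Proof.
move=> js; rewrite /fibre_sum (partition_big (fun y => y j) predT) //=.
by apply: eq_bigr => t _; apply: eq_bigl => y; rewrite agree_off_cons.
Qed.

Lemma fibre_sum_upd s j f x t : j \in s ->
  fibre_sum s f (upd x j t) = fibre_sum s f x.
Proof.
move=> js; apply: eq_bigl => y; apply: eq_forallb => k; rewrite ffunE.
by case: (eqVneq k j) => // ->; rewrite js.
Qed.

Lemma fibre_sum_full f x : fibre_sum (enum I) f x = \sum_y f y.
Proof.
by apply: eq_bigl => y; apply/forallP => j; rewrite mem_enum.
Qed.

End Sum.

Variable R : realType.

Lemma fibre_sum_ge0 s (f : {ffun I -> T} -> R) x :
  (forall y, 0 <= f y) -> 0 <= fibre_sum s f x.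
Proof. by move=> f0; apply: sumr_ge0 => y _. Qed.

(** The coordinates are summed out one at a time.  When [j] is summed, the
    factor of index [j] already is a sum over the coordinate [j], hence constant
    along that direction, and Hoelder's inequality applies to the other
    [#|I| - 1] factors, whose exponents [c] add up to [1].  Writing every factor
    as a sum over its own coordinate makes this constancy part of the
    notation: both [i] and [s] are summed in [fibre_sum (i :: s) (d i)], where
    [i] may already belong to [s]. *)
Lemma loomis_whitney_fibre (d : I -> {ffun I -> T} -> R) (c : R) s x :
    (forall i y, 0 <= d i y) -> (#|I|.-1)%:R * c = 1 -> uniq s ->
  fibre_sum s (fun y => \prod_i fibre_sum [:: i] (d i) y `^ c) x
    <= \prod_i fibre_sum (i :: s) (d i) x `^ c.
Proof.
move=> d0 cE; have c0 := natr_mul1_ge0 cE.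
elim: s x => [|j s IH] x /=; first by rewrite fibre_sum_nil.
move=> /andP[js us]; rewrite fibre_sum_cons //.
apply: (@le_trans _ _ (\sum_t
    fibre_sum (j :: s) (d j) x `^ c *
    \prod_(i | i != j) fibre_sum (i :: s) (d i) (upd x j t) `^ c)).
  apply: ler_sum => t _; apply: le_trans (IH _ us) _.
  rewrite (bigD1 j) //= fibre_sum_upd ?mem_head //.
rewrite -mulr_sumr [leRHS](bigD1 j) //=.
rewrite (@eq_fibre_sum _ [:: j, j & s] (j :: s)); last first.
  by move=> k; rewrite !inE orbA orbb.
rewrite ler_wpM2l ?powR_ge0 //.
apply: le_trans (@sum_prod_powR_le _ _ _ _ (fun=> c)
  (fun i t => fibre_sum (i :: s) (d i) (upd x j t)) _ _ _) _.
- by [].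
- by rewrite sumr_const cardC1 -[LHS]mulr_natl.
- by move=> i t _; exact: fibre_sum_ge0.
rewrite le_eqVlt; apply/orP; left; apply/eqP/eq_bigr => i ij; congr (_ `^ _).
rewrite -fibre_sum_cons ?inE ?negb_or 1?eq_sym ?ij //.
by apply: eq_fibre_sum => k; rewrite !inE orbCA.
Qed.

Lemma loomis_whitney (d : I -> {ffun I -> T} -> R) (c : R) :
    (forall i y, 0 <= d i y) -> (#|I|.-1)%:R * c = 1 ->
  \sum_x \prod_i (\sum_t d i (upd x i t)) `^ c
    <= \prod_i (\sum_x d i x) `^ c.
Proof.
move=> d0 cE; have [x _|K0] := pickP {: {ffun I -> T}}; last first.
  by rewrite [leLHS]big_pred0 // prodr_ge0 // => i _; exact: powR_ge0.
have lineE i y : \sum_t d i (upd y i t) = fibre_sum [:: i] (d i) y.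
  rewrite fibre_sum_cons //; apply: eq_bigr => t _.
  by rewrite fibre_sum_nil.
have -> : \sum_x \prod_i (\sum_t d i (upd x i t)) `^ c
    = \sum_x \prod_i fibre_sum [:: i] (d i) x `^ c.
  by apply: eq_bigr => y _; apply: eq_bigr => i _; rewrite lineE.
have := @loomis_whitney_fibre d c _ x d0 cE (enum_uniq I).
rewrite fibre_sum_full => /le_trans; apply; apply: ler_prod => i _.
rewrite powR_ge0 /=.
rewrite (@eq_fibre_sum _ _ (enum I)) ?fibre_sum_full // => k.
by rewrite inE !mem_enum orbT.
Qed.

End FibreSums.

(** * The Sobolev inequality on a discrete torus *)

Section DiscreteSobolev.
Variable R : realType.

(** Telescope from [ord0] up to [s], and drop the remaining differences. *)
Lemma norm_le_sum_cyclic_diff N (G : 'I_N.+1 -> R) s : G ord0 = 0 ->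
  `|G s| <= \sum_t `|G (ordS t) - G t|.
Proof.
move=> G0; pose a k := `|G (ordS (inord k)) - G (inord k)|.
have tele m : (m <= N)%N -> `|G (inord m)| <= \sum_(0 <= k < m) a k.
  elim: m => [_|m IH mN].
    rewrite big_geq // (_ : inord 0 = ord0) ?G0 ?normr0 //.
    by apply: val_inj; rewrite /= inordK.
  rewrite big_nat_recr //= addrC /a.
  have -> : ordS (inord m) = inord m.+1 :> 'I_N.+1.
    by apply: val_inj; rewrite /= !inordK ?modn_small // ltnS ltnW.
  rewrite -[X in `|X| <= _](subrK (G (inord m))).
  by apply: le_trans (ler_normD _ _) _; rewrite lerD2l IH // ltnW.
have := tele s; rewrite -ltnS ltn_ord inord_val => /(_ isT) /le_trans; apply.
have -> : \sum_t `|G (ordS t) - G t| = \sum_(0 <= k < N.+1) a k.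
  by rewrite big_mkord; apply: eq_bigr => t _; rewrite /a inord_val.
rewrite (@big_cat_nat _ _ _ s 0 N.+1) //= ?(ltnW (ltn_ord s)) // lerDl.
by apply: sumr_ge0 => k _; exact: normr_ge0.
Qed.

Variables (n N : nat).
Implicit Types (x : {ffun 'I_n -> 'I_N.+1}) (i : 'I_n).

Definition next i x := upd x i (ordS (x i)).

Lemma next_inj i : injective (next i).
Proof.
move=> x y /ffunP xy; apply/ffunP => j; have := xy j; rewrite !ffunE.
by case: (eqVneq j i) => // -> /ordS_inj.
Qed.

Lemma next_upd i x t : next i (upd x i t) = upd x i (ordS t).
Proof. by apply/ffunP => j; rewrite !ffunE eqxx; case: eqP. Qed.

(** The Sobolev inequality for the exponent [1]: [|F x|^c] is at most the [c]-th
    power of the sum of the differences along each of the [n] lines through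
    [x], and the product of these [n] bounds is summed by Loomis-Whitney. *)
Lemma discrete_gagliardo (F : {ffun 'I_n -> 'I_N.+1} -> R) (c : R) :
    (forall i x, x i = ord0 -> F x = 0) -> n.-1%:R * c = 1 ->
  \sum_x `|F x| `^ (n%:R * c)
    <= \prod_i (\sum_x `|F (next i x) - F x|) `^ c.
Proof.
move=> F0 cE; apply: le_trans (@loomis_whitney _ _ _
  (fun i x => `|F (next i x) - F x|) c _ _); last by rewrite card_ord.
  apply: ler_sum => x _.
  have -> : `|F x| `^ (n%:R * c) = \prod_(i < n) `|F x| `^ c.
    by rewrite prodr_const card_ord mulrC powRrM powR_mulrn // powR_ge0.
  apply: ler_prod => i _; rewrite powR_ge0 /=.
  rewrite ge0_ler_powR ?nnegrE ?sumr_ge0 //; first exact: natr_mul1_ge0 cE.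
  rewrite -{1}(upd_eval x i); under eq_bigr do rewrite next_upd.
  apply: (@norm_le_sum_cyclic_diff _ (fun t => F (upd x i t))).
  by apply: (F0 i); rewrite ffunE eqxx.
by move=> i x; exact: normr_ge0.
Qed.

(** Hoelder's inequality with exponents [1/r] and [1 - 1/r], after
    [powR_sub_le].  The relation between [g] and [q] makes the second factor a
    power of the same sum of [|F|^q] for both end points, because [next i]
    permutes the torus. *)
Lemma sum_powR_diff_le (F : {ffun 'I_n -> 'I_N.+1} -> R) (r q g : R) i :
    1 <= r -> 1 <= g -> g - 1 = q * (1 - r^-1) ->
  \sum_x `| `|F (next i x)| `^ g - `|F x| `^ g|
    <= 2 * g * (\sum_x `|F (next i x) - F x| `^ r) `^ r^-1
       * (\sum_x `|F x| `^ q) `^ (1 - r^-1).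
Proof.
move=> r1 g1 gE; have r0 : 0 < r by lra.
have g0 : 0 < g by lra.
have rV : 0 <= r^-1 <= 1 by rewrite invr_ge0 invf_le1 // r1 ltW.
pose D x := `|F (next i x) - F x| `^ r.
have D0 x : 0 <= D x by exact: powR_ge0.
have DE x : `|F (next i x) - F x| = D x `^ r^-1.
  by rewrite -powRrM divff ?gt_eqF // powRr1.
have FE x : `|F x| `^ (g - 1) = (`|F x| `^ q) `^ (1 - r^-1).
  by rewrite gE powRrM.
apply: (@le_trans _ _ (g * ((\sum_x D x `^ r^-1 *
    (`|F (next i x)| `^ q) `^ (1 - r^-1)) +
    \sum_x D x `^ r^-1 * (`|F x| `^ q) `^ (1 - r^-1)))).
  rewrite -big_split mulr_sumr /=; apply: ler_sum => x _.
  apply: le_trans (powR_sub_le g1 (normr_ge0 _) (normr_ge0 _)) _.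
  rewrite -mulrDr -!FE -DE ler_wpM2l ?(ltW g0) // ler_wpM2r //.
  exact: ler_dist_dist.
rewrite -!mulrA (mulrCA 2) ler_wpM2l ?(ltW g0) // mulr_natl mulr2n.
apply: lerD; last by apply: hoelder_sum => // x; exact: powR_ge0.
rewrite [X in _ * X `^ _](reindex_inj (@next_inj i)) /=.
by apply: hoelder_sum => // x; exact: powR_ge0.
Qed.

(** [g = q * (1 - 1/n)] is the power for which [discrete_gagliardo], applied to
    [|F|^g], produces the sum [X] of [|F|^q] on the left.  After taking the
    power [1 - 1/n] of both sides, the left one is [X^(1 - 1/n)] and the right
    one contains [X^(1 - 1/r)]; as [1 - 1/n = 1/q + (1 - 1/r)], dividing leaves
    [X^(1/q)]. *)
Lemma discrete_sobolev (F : {ffun 'I_n -> 'I_N.+1} -> R) (r q : R) :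
    (1 < n)%N -> 1 <= r < n%:R -> q^-1 = r^-1 - n%:R^-1 ->
    (forall i x, x i = ord0 -> F x = 0) ->
  (\sum_x `|F x| `^ q) `^ q^-1
    <= 2 * (q * (1 - n%:R^-1))
       * (\sum_(i < n) \sum_x `|F (next i x) - F x| `^ r) `^ r^-1.
Proof.
move=> n1 /andP[r1 rn] qE F0; set g := q * _.
have n1R : 1 < n%:R :> R by rewrite ltr1n.
have qV0 : 0 < q^-1 by rewrite qE subr_gt0 ltf_pV2 ?posrE; lra.
have q0 : 0 < q by rewrite -invr_gt0.
have r0 : 0 < r by lra.
have nr0 : 0 < n%:R - r by lra.
have qF : q = r * n%:R / (n%:R - r).
  by rewrite -[LHS]invrK qE; field; rewrite !gt_eqF //; lra.
have gE : g - 1 = q * (1 - r^-1).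
  by rewrite /g qF; field; rewrite !gt_eqF //; lra.
have rV : 0 <= r^-1 <= 1 by rewrite invr_ge0 invf_le1 // r1 ltW.
have g1 : 1 <= g.
  by rewrite -subr_ge0 gE mulr_ge0 ?(ltW q0) // subr_ge0; case/andP: rV.
set X := \sum_x `|F x| `^ q; set E := \sum_(i < n) _.
have X0 : 0 <= X by apply: sumr_ge0 => x _; exact: powR_ge0.
have Ei0 i : 0 <= \sum_x `|F (next i x) - F x| `^ r.
  by apply: sumr_ge0 => x _; exact: powR_ge0.
have E0 : 0 <= E by apply: sumr_ge0 => i _.
have [->|Xn0] := eqVneq X 0.
  by rewrite powR0 ?gt_eqF // !mulr_ge0 ?powR_ge0 //; lra.
have X_gt0 : 0 < X by rewrite lt_def Xn0.
pose c : R := (n%:R - 1)^-1.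
have c0 : 0 < c by rewrite invr_gt0; lra.
have cE : n.-1%:R * c = 1.
  by rewrite -subn1 natrB ?(ltnW n1) // divff // gt_eqF //; lra.
pose B := 2 * g * E `^ r^-1 * X `^ (1 - r^-1).
have B0 : 0 <= B by rewrite !mulr_ge0 ?powR_ge0 //; lra.
have XB : X <= B `^ (n%:R * c).
  have Fg0 i x : x i = ord0 -> `|F x| `^ g = 0.
    by move=> /F0 ->; rewrite normr0 powR0 // gt_eqF //; lra.
  have := discrete_gagliardo Fg0 cE.
  have -> : \sum_x `| `|F x| `^ g| `^ (n%:R * c) = X.
    apply: eq_bigr => x _; rewrite ger0_norm ?powR_ge0 // -powRrM.
    congr (_ `^ _); rewrite /g /c; field.
    by rewrite !gt_eqF //; lra.
  move=> /le_trans; apply.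
  have -> : B `^ (n%:R * c) = \prod_(i < n) B `^ c.
    by rewrite prodr_const card_ord mulrC powRrM powR_mulrn // powR_ge0.
  apply: ler_prod => i _; rewrite powR_ge0 /= ge0_ler_powR ?nnegrE ?(ltW c0) //.
    by apply: sumr_ge0 => x _; exact: normr_ge0.
  apply: le_trans (sum_powR_diff_le F i r1 g1 gE) _.
  rewrite ler_wpM2r ?powR_ge0 // ler_wpM2l //; first by lra.
  rewrite ge0_ler_powR ?nnegrE //; first by case/andP: rV.
  by rewrite /E (bigD1 i) //= lerDl sumr_ge0.
have : X `^ (1 - n%:R^-1) <= B.
  have nc : n%:R * c * (1 - n%:R^-1) = 1.
    by rewrite /c; field; rewrite !gt_eqF //; lra.
  have -> : B = (B `^ (n%:R * c)) `^ (1 - n%:R^-1).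
    by rewrite -powRrM nc powRr1.
  rewrite ge0_ler_powR ?nnegrE ?powR_ge0 //.
  by rewrite subr_ge0 invf_le1; lra.
have -> : 1 - n%:R^-1 = q^-1 + (1 - r^-1) by rewrite qE; ring.
rewrite powRD ?Xn0 ?implybT // /B.
by rewrite ler_pM2r // powR_gt0.
Qed.

End DiscreteSobolev.

(** * Sums over finite subsets *)

Section SumOnImage.
Variables (R : numDomainType) (I : finType) (J : choiceType).
Implicit Types (P : pred I) (h : I -> J) (W : set J) (F : J -> R).

Lemma fsbig_pred P (G : I -> R) :
  \sum_(k \in [set` P]) G k = \sum_(k | P k) G k.
Proof.
rewrite -(@bigfs _ _ _ _ (index_enum I)) ?index_enum_uniq // => k _.
by rewrite mem_index_enum.
Qed.

Lemma sum_image_le P h W F : finite_set W -> (forall x, 0 <= F x) ->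
    {in P &, injective h} -> (forall k, P k -> W (h k)) ->
  \sum_(k | P k) F (h k) <= \sum_(x \in W) F x.
Proof.
move=> fW F0 hI hW; pose Q := [set` P].
have QW : h @` Q `<=` W by move=> _ [k Pk <-]; exact: hW.
rewrite -fsbig_pred -(@fsbig_image _ _ _ _ _ Q h F); last first.
  by move=> a b; rewrite !inE; exact: hI.
rewrite [leRHS](fsbigID (h @` Q)) ?(setIidr QW) //.
by rewrite lerDl; apply: fsumr_ge0.
Qed.

End SumOnImage.

(** * From the mesh to the discrete torus *)

Section Lattice.
Variables (R : realType) (n N : nat).
Local Notation h := (mesh_size R N).
Implicit Types (k : {ffun 'I_n -> 'I_N.+1}) (i j : 'I_n) (u : 'rV[R]_n -> R).

Definition lattice_point k : 'rV[R]_n := \row_j ((k j)%:R * h).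

Definition interior k := [forall j, k j != ord0].

(** Off the interior this is [0] even where [lattice_point k] lies on an edge or
    a corner of the cube, at which [u] is unconstrained: no difference on the
    dual meshes sees those points. *)
Definition zero_extension u k := if interior k then u (lattice_point k) else 0.

Lemma mesh_size_gt0 : 0 < h.
Proof. by rewrite invr_gt0. Qed.

Lemma lattice_point_inj : injective lattice_point.
Proof.
move=> k1 k2 /rowP kk; apply/ffunP => j; apply: val_inj; have := kk j.
rewrite !mxE => /(mulIf (lt0r_neq0 mesh_size_gt0))/eqP.
by rewrite eqr_nat => /eqP.
Qed.

Lemma mesh_lattice_point k : mesh N (lattice_point k) <-> interior k.
Proof.
split=> [[kcube _]|/forallP kint].
  apply/forallP => j; apply: contraTneq isT => kj.
  by have := kcube j; rewrite mxE kj mul0r ltxx.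
have kj0 j : (0 < k j)%N by rewrite lt0n; exact: kint.
split=> j; rewrite !mxE.
  rewrite mulr_gt0 ?ltr0n ?mesh_size_gt0 //=.
  by rewrite ltr_pdivrMr ?ltr0n // mul1r ltr_nat.
by exists (k j) => //=; rewrite kj0 -ltnS /=.
Qed.

Lemma meshE : mesh N = lattice_point @` [set` interior].
Proof.
apply/seteqP; split=> [x xM|_ [k /= kint <-]]; last exact/mesh_lattice_point.
have xN j : exists m : 'I_N.+1, m%:R * h = x 0 j.
  have [m /andP[_ mN] <-] := xM.2 j.
  by exists (inord m); rewrite inordK.
have [k kE] := choice xN.
have xE : lattice_point (finfun k) = x.
  by apply/rowP => j; rewrite mxE ffunE.
by exists (finfun k) => //; apply/mesh_lattice_point; rewrite xE.
Qed.

Lemma half_step2 i :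
  half_step R N i + half_step R N i = h *: delta_mx 0 i.
Proof. by rewrite -scalerDl -splitr. Qed.

Lemma lattice_point_next i k : next i k i != ord0 ->
  lattice_point (next i k) = lattice_point k + h *: delta_mx 0 i.
Proof.
rewrite ffunE eqxx => ki0.
have kiE : ordS (k i) = (k i).+1 :> nat.
  rewrite /= modn_small // ltn_neqAle ltn_ord andbT.
  by apply: contra_neqN ki0 => /eqP kN; apply: val_inj; rewrite /= kN modnn.
apply/rowP => j; rewrite !mxE ffunE; case: (eqVneq j i) => [->|ji].
  by rewrite kiE eqxx /= mulr1 -natr1 mulrDl mul1r.
by rewrite andbF mulr0 addr0.
Qed.

Lemma zero_extension0 u i k : k i = ord0 -> zero_extension u k = 0.
Proof.
move=> ki; rewrite /zero_extension ifN //.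
by apply/forallPn; exists i; rewrite ki eqxx.
Qed.

Section Boundary.
Variable u : 'rV[R]_n -> R.
Hypothesis u0 : forall x, mesh_boundary N x -> u x = 0.

Lemma boundary_step i x : mesh N x ->
  ~ mesh N (x + h *: delta_mx 0 i) -> u (x + h *: delta_mx 0 i) = 0.
Proof.
move=> xM xi; apply: u0; exists i => //; split=> //.
left; exists (x + half_step R N i); first by left; exists x.
by rewrite -addrA half_step2.
Qed.

Lemma boundary_step_back i x : ~ mesh N x ->
  mesh N (x + h *: delta_mx 0 i) -> u x = 0.
Proof.
move=> xM xi; apply: u0; exists i => //; split=> //.
right; exists (x + half_step R N i); last by rewrite addrK.
right; exists (x + h *: delta_mx 0 i) => //.
by rewrite -half_step2 addrA addrK.
Qed.

(** At the points [k] that fail this condition the cyclic difference of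
    [zero_extension] is [0 - 0]; at the others it is a difference of [u] across
    a point of the dual mesh. *)
Definition edge i k := interior k || interior (next i k).

Lemma dual_mesh_edge i k : edge i k ->
  dual_mesh N i (mesh N) (lattice_point k + half_step R N i).
Proof.
case/orP => kint.
  by left; exists (lattice_point k) => //; exact/mesh_lattice_point.
right; exists (lattice_point (next i k)); first exact/mesh_lattice_point.
rewrite lattice_point_next; last exact: (forallP kint).
by rewrite -half_step2 addrA addrK.
Qed.

(** One end of an edge is a mesh point; the other one is either a mesh point,
    where the extension agrees with [u], or a boundary point, where both
    vanish.  If [k i = N] the edge wraps around the torus, to a point with
    [i]-th coordinate [0] that replaces the one with coordinate [N + 1]. *)
Lemma mesh_diff_edge i k : edge i k ->
  mesh_diff N i u (lattice_point k + half_step R N i)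
    = h^-1 * (zero_extension u (next i k) - zero_extension u k).
Proof.
move=> kE; rewrite /mesh_diff addrK -addrA half_step2; congr (_ * (_ - _)).
  rewrite /zero_extension; case: ifPn => kint.
    by rewrite lattice_point_next //; exact: (forallP kint).
  have kM : mesh N (lattice_point k).
    by apply/mesh_lattice_point; move: kE; rewrite /edge (negbTE kint) orbF.
  apply: boundary_step => //.
  move=> kM'; have := kM'; rewrite meshE => -[k' /= k'int k'E].
  suff k'n : k' = next i k by case/negP: kint; rewrite -k'n.
  move/rowP: k'E => k'E; apply/ffunP => j; rewrite ffunE; apply: val_inj.
  have := k'E j; rewrite !mxE; case: (eqVneq j i) => [->|ji] /=; last first.
    rewrite mulr0 addr0 => /(mulIf (lt0r_neq0 mesh_size_gt0))/eqP.
    by rewrite eqr_nat => /eqP.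
  rewrite mulr1 -[X in _ + X]mul1r -mulrDl natr1 => /(mulIf (lt0r_neq0 mesh_size_gt0))/eqP.
  by rewrite eqr_nat => /eqP k'S; rewrite modn_small -k'S.
rewrite /zero_extension; case: ifPn => // kint.
have kint' : interior (next i k) by move: kE; rewrite /edge (negbTE kint).
apply: (@boundary_step_back i).
  by move=> /mesh_lattice_point; exact/negP.
rewrite -lattice_point_next; first exact/mesh_lattice_point.
exact: (forallP kint').
Qed.

Lemma mesh_sum_zero_extension q : q != 0 ->
  \sum_(x \in mesh N) `|u x| `^ q = \sum_k `|zero_extension u k| `^ q.
Proof.
move=> q0; rewrite meshE (fsbig_image _ _ (fun x => `|u x| `^ q)); last first.
  by move=> k1 k2 _ _; exact: lattice_point_inj.
rewrite (fsbig_pred interior) big_mkcond; apply: eq_bigr => k _.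
by rewrite /zero_extension; case: ifP; rewrite ?normr0 ?powR0.
Qed.

Lemma dual_sum_zero_extension_le i p : 0 < p ->
  h `^ (- p) * \sum_k `|zero_extension u (next i k) - zero_extension u k| `^ p
    <= \sum_(x \in dual_mesh N i (mesh N)) `|mesh_diff N i u x| `^ p.
Proof.
move=> p0.
have -> : h `^ (- p)
      * \sum_k `|zero_extension u (next i k) - zero_extension u k| `^ p
    = \sum_(k | edge i k)
        `|mesh_diff N i u (lattice_point k + half_step R N i)| `^ p.
  rewrite [RHS]big_mkcond mulr_sumr; apply: eq_bigr => k _; case: ifPn => kE.
    have h0 := ltW mesh_size_gt0.
    rewrite mesh_diff_edge // normrM powRM // ger0_norm ?invr_ge0 //.
    by rewrite -[h^-1]powR_inv1 // -powRrM mulN1r.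
  move: kE; rewrite /edge negb_or /zero_extension.
  by move=> /andP[/negbTE -> /negbTE ->]; rewrite subrr normr0 powR0 ?gt_eqF // mulr0.
apply: (sum_image_le (F := fun x => `|mesh_diff N i u x| `^ p)).
- exact/finite_dual_mesh/finite_mesh.
- by move=> x; exact: powR_ge0.
- by move=> k1 k2 _ _ /addIr /lattice_point_inj.
- by move=> k; exact: dual_mesh_edge.
Qed.

End Boundary.

(** Hoelder's inequality against the constant [1]; [n * h^(-n)] is the number
    of terms. *)
Lemma discrete_Lnorm_le (F : {ffun 'I_n -> 'I_N.+1} -> R) (r p : R) :
    0 < r <= p ->
  (\sum_(i < n) \sum_k `|F (next i k) - F k| `^ r) `^ r^-1
   <= (n%:R * h `^ (- n%:R)) `^ (r^-1 - p^-1)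
      * (\sum_(i < n) \sum_k `|F (next i k) - F k| `^ p) `^ p^-1.
Proof.
move=> /andP[r0 rp]; have p0 : 0 < p by lra.
rewrite !pair_bigA /=.
pose D (z : 'I_n * {ffun 'I_n -> 'I_N.+1}) := `|F (next z.1 z.2) - F z.2|.
have c01 : 0 <= r / p <= 1.
  by rewrite divr_ge0 ?(ltW r0) ?(ltW p0) //= ler_pdivrMr // mul1r.
have := @hoelder_sum R _ (fun z => D z `^ p) (fun=> 1) (r / p)
  (fun z => powR_ge0 _ _) (fun=> ler01) c01.
have -> : \sum_z (D z `^ p) `^ (r / p) * 1 `^ (1 - r / p) = \sum_z D z `^ r.
  apply: eq_bigr => z _; rewrite powR1 mulr1 -powRrM mulrCA divff ?gt_eqF //.
  by rewrite mulr1.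
have -> : \sum_(z : 'I_n * {ffun 'I_n -> 'I_N.+1}) 1 = n%:R * h `^ (- n%:R) :> R.
  rewrite sumr_const card_prod card_ord card_ffun !card_ord natrM natrX.
  by rewrite powRN powR_mulrn ?(ltW mesh_size_gt0) // exprVn invrK.
have rV : 0 <= r^-1 by rewrite invr_ge0 ltW.
set M := n%:R * _; have M0 : 0 <= M by rewrite mulr_ge0 ?powR_ge0.
have Dr0 : 0 <= \sum_z D z `^ r by apply: sumr_ge0 => z _; exact: powR_ge0.
move=> /(ge0_ler_powR rV); rewrite !nnegrE Dr0 mulr_ge0 ?powR_ge0 //.
move=> /(_ isT isT) /le_trans; apply.
rewrite powRM ?powR_ge0 // -!powRrM mulrC.
have -> : (1 - r / p) * r^-1 = r^-1 - p^-1 by field; rewrite !gt_eqF.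
by have -> : r / p * r^-1 = p^-1 by field; rewrite !gt_eqF.
Qed.

(** The powers of [h] balance: [h^(n/q)] comes from the integral on the left,
    [h^(-n(1/r - 1/p))] from the change of exponent, and
    [n/q - n(1/r - 1/p) = n/p - 1] is the power of [h] that relates the
    norm of the differences to that of the difference quotients. *)
Lemma mesh_sobolev (p r q : R) u :
    (1 < n)%N -> 1 <= r < n%:R -> r <= p -> q^-1 = r^-1 - n%:R^-1 ->
    (forall x, mesh_boundary N x -> u x = 0) ->
  mesh_Lnorm N q (mesh N) u
    <= 2 * (q * (1 - n%:R^-1)) * n%:R `^ (r^-1 - p^-1) * mesh_W1norm N p u.
Proof.
move=> n1 rn rp qE u0; have [r1 rn'] := andP rn.
have n1R : 1 < n%:R :> R by rewrite ltr1n.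
have qV0 : 0 < q^-1 by rewrite qE subr_gt0 ltf_pV2 ?posrE; lra.
have q0 : 0 < q by rewrite -invr_gt0.
have p0 : 0 < p by lra.
have pV0 : 0 < p^-1 by rewrite invr_gt0.
have h0 := mesh_size_gt0; have h0' := ltW h0.
pose F := zero_extension u; set K := 2 * _.
have K0 : 0 <= K.
  by rewrite !mulr_ge0 ?(ltW q0) // subr_ge0 invf_le1; lra.
pose E s := \sum_(i < n) \sum_k `|F (next i k) - F k| `^ s.
have E0 s : 0 <= E s.
  by apply: sumr_ge0 => i _; apply: sumr_ge0 => k _; exact: powR_ge0.
have W : h `^ (n%:R / p - 1) * E p `^ p^-1 <= mesh_W1norm N p u.
  have -> : h `^ (n%:R / p - 1) * E p `^ p^-1
      = (h `^ (n%:R - p) * E p) `^ p^-1.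
    by rewrite powRM ?powR_ge0 // -powRrM mulrBl divff ?gt_eqF.
  rewrite /mesh_W1norm ge0_ler_powR ?nnegrE ?(ltW pV0) //.
  - by rewrite mulr_ge0 ?powR_ge0.
  - by rewrite addr_ge0 ?powR_ge0 // sumr_ge0 // => i _; exact: powR_ge0.
  rewrite ler_wpDl ?powR_ge0 // mulr_sumr; apply: ler_sum => i _.
  rewrite /mesh_Lnorm -powRrM mulVf ?gt_eqF // powRr1; last first.
    by rewrite mulr_ge0 ?exprn_ge0 // fsumr_ge0 // => x _; exact: powR_ge0.
  rewrite (@powRD _ h); last by rewrite (gt_eqF h0) implybT.
  rewrite -mulrA powR_mulrn // ler_wpM2l ?exprn_ge0 //.
  exact: dual_sum_zero_extension_le.
apply: le_trans (ler_wpM2l _ W); last by rewrite mulr_ge0 ?powR_ge0.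
have XE : 0 <= \sum_k `|F k| `^ q by apply: sumr_ge0 => k _; exact: powR_ge0.
rewrite /mesh_Lnorm /mesh_integral mesh_sum_zero_extension ?gt_eqF //.
rewrite powRM ?exprn_ge0 // -powR_mulrn // -powRrM.
apply: (@le_trans _ _ (h `^ (n%:R / q) * (K * E r `^ r^-1))).
  rewrite ler_wpM2l ?powR_ge0 //; apply: discrete_sobolev => //.
  by move=> i k; exact: zero_extension0.
have rp' : 0 < r <= p by rewrite rp andbT; lra.
apply: (@le_trans _ _ (h `^ (n%:R / q) * (K *
    ((n%:R * h `^ (- n%:R)) `^ (r^-1 - p^-1) * E p `^ p^-1)))).
  by rewrite !ler_wpM2l ?powR_ge0 //; exact: discrete_Lnorm_le.
rewrite powRM ?powR_ge0 // -powRrM.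
have -> : n%:R / p - 1 = n%:R / q + - n%:R * (r^-1 - p^-1).
  by rewrite qE; field; rewrite !gt_eqF //; lra.
rewrite (@powRD _ h); last by rewrite (gt_eqF h0) implybT.
by rewrite le_eqVlt; apply/orP; left; apply/eqP; ring.
Qed.

End Lattice.

Theorem theorem1p5 (R : realType) (n : nat) (hn : (1 < n)%N) (p pstar : R)
  (hpq : (1 <= p < n%:R /\ pstar^-1 = p^-1 - (n%:R)^-1)
         \/ (p = n%:R /\ p <= pstar)) :
  exists C : R, forall (N : nat) (u : 'rV[R]_n -> R),
    (forall x, mesh_boundary N x -> u x = 0) ->
    mesh_Lnorm N pstar (mesh N) u <= C * mesh_W1norm N p u.
Proof.
case: hpq => [[pn qE]|[pn pq]].
  by eexists => N u u0; exact: (mesh_sobolev hn pn (lexx p) qE u0).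
have n2R : 2 <= n%:R :> R by rewrite ler_nat.
have nq : n%:R <= pstar by rewrite -pn.
have q0 : 0 < pstar by lra.
have n0 : 0 < n%:R :> R by lra.
have qV : pstar^-1 <= n%:R^-1 by rewrite lef_pV2 ?posrE.
have nV : n%:R^-1 <= 2^-1 :> R by rewrite lef_pV2 ?posrE.
have qV0 : 0 < pstar^-1 by rewrite invr_gt0.
have nV0 : 0 < n%:R^-1 :> R by rewrite invr_gt0.
(* [r] is the exponent below [n] whose Sobolev conjugate is [pstar] *)
pose r := (pstar^-1 + n%:R^-1)^-1.
have rn : 1 <= r < n%:R.
  rewrite /r -[X in X <= _]invr1 lef_pV2 ?posrE; [|lra..].
  by rewrite -[ltRHS]invrK ltf_pV2 ?posrE; lra.
have rp : r <= p by rewrite pn; case/andP: rn => _ /ltW.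
have qE : pstar^-1 = r^-1 - n%:R^-1 by rewrite /r invrK addrK.
by eexists => N u u0; exact: (mesh_sobolev hn rn rp qE u0).
Qed.
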